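(* Let $K=\mathrm{SU}(2)$ and let $\mathbf{SG}_2\subset K^2$ be the set of pairs having spectral gap. Then $\mathbf{SG}_2$ is either meager or comeager in $K^2$.
   Context: $K=\mathrm{SU}(2)$ with its normalized Haar measure. $\lambda$ denotes the left regular representation of $K$ on $L^2(K)$, $(\lambda(g)f)(h)=f(g^{-1}h)$, and $L^2_0(K)$ is the subspace of functions orthogonal to the constants. An $n$-tuple $(g_1,\dots,g_n)\in K^n$ is said to have spectral gap if there exists $\varepsilon>0$ such that for every $v\in L^2_0(K)$ there is some $k\in\{1,\dots,n\}$ with $\|\lambda(g_k)v-v\|\ge\varepsilon\|v\|$. $\mathbf{SG}_n\subset K^n$ denotes the set of $n$-tuples having spectral gap. *)

(* Defs.v *)
From HB Require Import structures.
From mathcomp Require Import all_boot all_order all_algebra.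
From mathcomp Require Import all_classical all_reals all_analysis.
Import Order.TTheory GRing.Theory Num.Theory.
Import numFieldNormedType.Exports.

Set Implicit Arguments.
Unset Strict Implicit.
Unset Printing Implicit Defensive.

Local Open Scope classical_set_scope.
Local Open Scope ring_scope.

(** * Ambient space.
    An element ((a, b), (c, d)) of R^4 encodes the complex 2x2 matrix
        [[ alpha, - conj beta ], [ beta, conj alpha ]]
    with alpha = a + i b and beta = c + i d.  Such a matrix lies in SU(2)
    iff |alpha|^2 + |beta|^2 = 1, and every element of SU(2) is of this form
    (uniquely).  R^4 carries its usual (product) topology and its Borel
    (= product Borel) sigma-algebra. *)
Notation su2amb R := ((R * R) * (R * R))%type.

Section SU2.
Variable R : realType.

Definition su2_alpha_re (x : su2amb R) : R := x.1.1.
Definition su2_alpha_im (x : su2amb R) : R := x.1.2.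
Definition su2_beta_re (x : su2amb R) : R := x.2.1.
Definition su2_beta_im (x : su2amb R) : R := x.2.2.

Definition SU2 : set (su2amb R) :=
  [set x | x.1.1 ^+ 2 + x.1.2 ^+ 2 + x.2.1 ^+ 2 + x.2.2 ^+ 2 = 1].

(** Matrix product, in coordinates:
   [[a1, -b1*],[b1, a1*]] [[a2, -b2*],[b2, a2*]] has
   alpha = a1 a2 - conj(b1) b2  and  beta = b1 a2 + conj(a1) b2. *)
Definition su2_mul (x y : su2amb R) : su2amb R :=
  let: ((a1, b1), (c1, d1)) := x in
  let: ((a2, b2), (c2, d2)) := y in
  ((a1 * a2 - b1 * b2 - c1 * c2 - d1 * d2,
    a1 * b2 + b1 * a2 - c1 * d2 + d1 * c2),
   (c1 * a2 - d1 * b2 + a1 * c2 + b1 * d2,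
    c1 * b2 + d1 * a2 + a1 * d2 - b1 * c2)).

(** Inverse = conjugate transpose: alpha -> conj alpha, beta -> - beta. *)
Definition su2_inv (x : su2amb R) : su2amb R :=
  let: ((a, b), (c, d)) := x in ((a, - b), (- c, - d)).

(** mu is the normalized Haar measure of SU(2): a Borel probability measure
    on R^4 carried by SU(2) and invariant under left translations
    h |-> g h by elements g of SU(2), i.e. mu(g A) = mu(A) for Borel A
    contained in SU(2). (Such a measure exists and is unique.) *)
Definition is_haar (mu : probability (su2amb R) R) : Prop :=
  mu SU2 = 1%E /\
  forall g, SU2 g -> forall A : set (su2amb R), measurable A ->
    mu (SU2 `&` (fun h => su2_mul (su2_inv g) h) @^-1` A) = mu (SU2 `&` A).

(** A complex valued function v = u + i w on SU(2) is represented by the pair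
    of real functions (u, w) (values outside SU(2) are irrelevant).
    v in L^2(K): measurable and square-integrable. *)
Definition inL2 (mu : probability (su2amb R) R) (u w : su2amb R -> R) : Prop :=
  [/\ measurable_fun SU2 u, measurable_fun SU2 w,
      mu.-integrable SU2 (fun x => (u x ^+ 2)%:E) &
      mu.-integrable SU2 (fun x => (w x ^+ 2)%:E)].

Definition inL2_0 (mu : probability (su2amb R) R) (u w : su2amb R -> R) : Prop :=
  [/\ inL2 mu u w,
      (\int[mu]_(x in SU2) (u x)%:E = 0)%E &
      (\int[mu]_(x in SU2) (w x)%:E = 0)%E].

Definition L2norm (mu : probability (su2amb R) R) (u w : su2amb R -> R) : R :=
  Num.sqrt (fine (\int[mu]_(x in SU2) ((u x ^+ 2 + w x ^+ 2)%:E))%E).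

Definition lreg (g : su2amb R) (f : su2amb R -> R) : su2amb R -> R :=
  fun h => f (su2_mul (su2_inv g) h).

Definition has_spectral_gap (mu : probability (su2amb R) R)
    (gs : seq (su2amb R)) : Prop :=
  exists2 eps : R, 0 < eps &
    forall u w, inL2_0 mu u w ->
      exists2 g, g \in gs &
        eps * L2norm mu u w <=
        L2norm mu (fun h => lreg g u h - u h) (fun h => lreg g w h - w h).

(** K^2 with its product topology, K = SU(2) with the subspace topology. *)
Definition SG2 (mu : probability (su2amb R) R) : set (SU2 * SU2)%type :=
  [set p | has_spectral_gap mu [:: set_val p.1; set_val p.2]].

End SU2.

Definition nowhere_dense {T : topologicalType} (A : set T) : Prop :=
  interior (closure A) = set0.

Definition meager {T : topologicalType} (A : set T) : Prop :=
  exists F : (set T)^nat, (forall n, nowhere_dense (F n)) /\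
    A `<=` \bigcup_n F n.

Definition comeager {T : topologicalType} (A : set T) : Prop :=
  meager (~` A).

(* Main.v *)
Require Import Defs.
From HB Require Import structures.
From mathcomp Require Import all_boot all_order all_algebra.
From mathcomp Require Import all_classical all_reals all_analysis.
From mathcomp Require Import measurable_realfun.
From mathcomp Require finmap.
From mathcomp Require Import ring lra zify.
Import Order.TTheory GRing.Theory Num.Theory.
Import numFieldNormedType.Exports.

(** Let [F_n] be the set of pairs whose spectral gap constant is at least [1/n].
    The regular representation is strongly continuous, so the closure of [F_n]
    still consists of pairs with spectral gap.  If every [F_n] is nowhere dense,
    the union of the [F_n] is meager.  Otherwise some open [U] consists of pairs
    with spectral gap.  If two words [w, w'] satisfy [(w(a,b), w'(a,b)) \in U],
    then [(a,b)] has spectral gap, since a vector almost fixed by [a] and [b] is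
    almost fixed by [w(a,b)] and [w'(a,b)].  The set of such [(a,b)] is open; it
    is dense because, after conjugation, [a] is diagonal and can be approximated
    by a root of unity of large prime order, whose powers almost fill the
    diagonal torus, while the torus and a generic [b] generate SU(2).  Hence its
    complement is nowhere dense. *)

Set Implicit Arguments.
Unset Strict Implicit.
Unset Printing Implicit Defensive.

Local Open Scope classical_set_scope.
Local Open Scope ring_scope.

(** * Quaternions *)

Section QuaternionAlgebra.
Variable R : realType.
Implicit Types x y z g : su2amb R.

Definition su2_one : su2amb R := ((1, 0), (0, 0)).

(** Projection form of the product: continuity and measurability can then be read off coordinate by
    coordinate, without destructing the arguments. *)
Lemma su2_mulE : @su2_mul R = fun x y : su2amb R =>
  ((x.1.1 * y.1.1 - x.1.2 * y.1.2 - x.2.1 * y.2.1 - x.2.2 * y.2.2,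
    x.1.1 * y.1.2 + x.1.2 * y.1.1 - x.2.1 * y.2.2 + x.2.2 * y.2.1),
   (x.2.1 * y.1.1 - x.2.2 * y.1.2 + x.1.1 * y.2.1 + x.1.2 * y.2.2,
    x.2.1 * y.1.2 + x.2.2 * y.1.1 + x.1.1 * y.2.2 - x.1.2 * y.2.1)).
Proof.
apply/funext => x; apply/funext => y.
by case: x => [[? ?] [? ?]]; case: y => [[? ?] [? ?]].
Qed.

Lemma su2_mulA x y z : su2_mul x (su2_mul y z) = su2_mul (su2_mul x y) z.
Proof.
case: x => [[? ?] [? ?]]; case: y => [[? ?] [? ?]]; case: z => [[? ?] [? ?]].
by rewrite /su2_mul; congr ((_, _), (_, _)); ring.
Qed.

Lemma su2_mul1 x : su2_mul x su2_one = x.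
Proof.
by case: x => [[? ?] [? ?]]; rewrite /su2_mul; congr ((_, _), (_, _)); ring.
Qed.

Lemma su2_1mul x : su2_mul su2_one x = x.
Proof.
by case: x => [[? ?] [? ?]]; rewrite /su2_mul; congr ((_, _), (_, _)); ring.
Qed.

Lemma su2_invM x y : su2_inv (su2_mul x y) = su2_mul (su2_inv y) (su2_inv x).
Proof.
case: x => [[? ?] [? ?]]; case: y => [[? ?] [? ?]].
by rewrite /su2_mul/su2_inv; congr ((_, _), (_, _)); ring.
Qed.

Lemma su2_invK : involutive (@su2_inv R).
Proof. by case=> [[? ?] [? ?]]; rewrite /su2_inv !opprK. Qed.

Lemma su2_mulV x : SU2 x -> su2_mul x (su2_inv x) = su2_one.
Proof.
case: x => [[a b] [c d]]; rewrite /SU2/= => h.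
by rewrite /su2_one -h /su2_mul/su2_inv; congr ((_, _), (_, _)); ring.
Qed.

Lemma su2_Vmul x : SU2 x -> su2_mul (su2_inv x) x = su2_one.
Proof.
case: x => [[a b] [c d]]; rewrite /SU2/= => h.
by rewrite /su2_one -h /su2_mul/su2_inv; congr ((_, _), (_, _)); ring.
Qed.

Lemma SU2_one : SU2 su2_one.
Proof. by rewrite /SU2/=; ring. Qed.

Lemma SU2_mul x y : SU2 x -> SU2 y -> SU2 (su2_mul x y).
Proof.
case: x => [[a b] [c d]]; case: y => [[a' b'] [c' d']]; rewrite /SU2/= => h h'.
transitivity ((a ^+ 2 + b ^+ 2 + c ^+ 2 + d ^+ 2) *
              (a' ^+ 2 + b' ^+ 2 + c' ^+ 2 + d' ^+ 2)); first by ring.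
by rewrite h h' mulr1.
Qed.

Lemma SU2_inv x : SU2 x -> SU2 (su2_inv x).
Proof. by case: x => [[a b] [c d]]; rewrite /SU2/= !sqrrN. Qed.

Lemma SU2_mulr g x : SU2 g -> SU2 (su2_mul g x) <-> SU2 x.
Proof.
move=> hg; split=> [h|]; last exact: SU2_mul.
by rewrite -[x]su2_1mul -(su2_Vmul hg) -su2_mulA; apply: SU2_mul => //; exact: SU2_inv.
Qed.

(** * Diagonal torus, Euler angles and diagonalization *)

Definition su2_diag (t : R) : su2amb R := ((cos t, sin t), (0, 0)).

Lemma SU2_diag t : SU2 (su2_diag t).
Proof. by rewrite /SU2/= cos2Dsin2; ring. Qed.

Lemma su2_diagD s t : su2_mul (su2_diag s) (su2_diag t) = su2_diag (s + t).
Proof.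
by rewrite /su2_mul/= /su2_diag cosD sinD; congr ((_, _), (_, _)); ring.
Qed.

Lemma su2_diag0 : su2_diag 0 = su2_one.
Proof. by rewrite /su2_diag cos0 sin0. Qed.

Definition su2_rot (c s : R) : su2amb R := ((c, 0), (s, 0)).

(** The number |beta|^2, which classifies the double cosets of the diagonal torus; see
    [kbeta2_biinvariant]. *)
Definition su2_beta2 x : R := x.2.1 ^+ 2 + x.2.2 ^+ 2.

Lemma su2_beta2_ge0 x : 0 <= su2_beta2 x.
Proof. by rewrite addr_ge0 ?sqr_ge0. Qed.

Lemma su2_beta2_le1 x : SU2 x -> su2_beta2 x <= 1.
Proof.
rewrite /SU2/= -addrA => <-; rewrite /su2_beta2 lerDr.
by rewrite addr_ge0 ?sqr_ge0.
Qed.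

(** The arccosine settles 0 <= s. For s < 0 it is reflected to 2 pi minus itself, which stays below
    2 pi because its sine |s| is nonzero. *)
Lemma circle_angle (c s : R) : c ^+ 2 + s ^+ 2 = 1 ->
  exists2 t : R, 0 <= t < pi *+ 2 & (c = cos t /\ s = sin t).
Proof.
move=> h.
have c1 : -1 <= c <= 1 by apply/andP; split; nra.
have sa : sin (acos c) = `|s|.
  by rewrite sin_acos// -h (addrC (c ^+ 2)) addrK sqrtr_sqr.
have pi0 := pi_gt0 R.
have [s0|s0] := leP 0 s.
  exists (acos c); last by rewrite acosK// sa ger0_norm.
  by rewrite acos_ge0//= mulr2n (le_lt_trans (acos_lepi _))// ltrDl.
have ac0 : 0 < acos c.
  rewrite lt_neqAle acos_ge0// andbT; apply/eqP => a0.
  by move: sa; rewrite -a0 sin0 => /esym/eqP; rewrite normr_eq0 lt_eqF.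
exists (pi *+ 2 - acos c).
  rewrite ltrBlDr ltrDl ac0 andbT subr_ge0 mulr2n.
  by rewrite (le_trans (acos_lepi _))// lerDl ltW.
by rewrite addrC mulr2n addrA cosDpi sinDpi cosDpi sinDpi !opprK cosN
   sinN acosK// sa ltr0_norm// opprK.
Qed.

Lemma polar (x y : R) : exists2 t : R, 0 <= t < pi *+ 2 &
  x = Num.sqrt (x ^+ 2 + y ^+ 2) * cos t /\ y = Num.sqrt (x ^+ 2 + y ^+ 2) * sin t.
Proof.
set r := Num.sqrt _.
have r2 : r ^+ 2 = x ^+ 2 + y ^+ 2 by rewrite sqr_sqrtr// addr_ge0 ?sqr_ge0.
have [r0|r0] := eqVneq r 0.
  have [x0 y0] : x = 0 /\ y = 0.
    move/eqP: r2; rewrite r0 expr0n/= eq_sym paddr_eq0 ?sqr_ge0//.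
    by rewrite !sqrf_eq0 => /andP[/eqP-> /eqP->].
  exists 0; last by rewrite r0 x0 y0 !mul0r.
  by rewrite lexx/= mulrn_wgt0 ?pi_gt0.
have [|t tb [tc ts]] := @circle_angle (x / r) (y / r).
  by rewrite !expr_div_n -mulrDl -r2 divff// sqrf_eq0.
by exists t => //; rewrite -tc -ts; split; rewrite mulrC divfK.
Qed.

(** Euler angles: the moduli of alpha and beta give the real rotation in the middle, and the
    diagonal factors carry the two phases. *)
Lemma su2_euler x : SU2 x -> exists p q,
  x = su2_mul (su2_mul (su2_diag p)
      (su2_rot (Num.sqrt (1 - su2_beta2 x)) (Num.sqrt (su2_beta2 x)))) (su2_diag q).
Proof.
case: x => [[a b] [c d]]; rewrite /SU2/= /su2_beta2/= => h.
have -> : 1 - (c ^+ 2 + d ^+ 2) = a ^+ 2 + b ^+ 2 by rewrite -h; ring.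
have [t _ [ha hb]] := polar a b; have [u _ [hc hd]] := polar c d.
pose r := Num.sqrt (a ^+ 2 + b ^+ 2); pose r' := Num.sqrt (c ^+ 2 + d ^+ 2).
(* The product has phase p + q in alpha and q - p in beta, to be matched with t and u. *)
pose p := (t - u) / 2; pose q := (t + u) / 2.
have E1 : t = p + q by rewrite /p /q; field.
have E2 : u = q - p by rewrite /p /q; field.
exists p, q; rewrite -/r -/r' in ha hb hc hd *.
rewrite {1}ha {1}hb {1}hc {1}hd E1 E2 cosD sinD cosB sinB.
by rewrite /su2_mul/=; congr ((_, _), (_, _)); ring.
Qed.

(* [g] is proportional to [u + i], where [x = c + s u] with [u] a unit
   imaginary quaternion: the half-turn about [u + i] carries [i] to [u]. *)
Lemma su2_diagonalize x : SU2 x -> exists g t,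
  [/\ SU2 g, 0 <= t < pi *+ 2 & su2_mul x g = su2_mul g (su2_diag t)].
Proof.
case: x => [[a b] [c d]] h.
pose s := Num.sqrt (b ^+ 2 + c ^+ 2 + d ^+ 2).
have s2 : s ^+ 2 = b ^+ 2 + c ^+ 2 + d ^+ 2.
  by rewrite sqr_sqrtr// !addr_ge0 ?sqr_ge0.
(* If beta = 0, the matrix is already diagonal, whereas u + i could vanish. *)
have [cd0|cd0] := eqVneq (c ^+ 2 + d ^+ 2) 0.
  have [c0 d0] : c = 0 /\ d = 0.
    move/eqP: cd0; rewrite paddr_eq0 ?sqr_ge0//.
    by rewrite !sqrf_eq0 => /andP[/eqP-> /eqP->].
  have [|t tb [tc ts]] := @circle_angle a b.
    by move: h; rewrite /SU2/= c0 d0 expr0n/= !addr0.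
  exists su2_one, t; split=> //; first exact: SU2_one.
  by rewrite su2_mul1 su2_1mul /su2_diag -tc -ts c0 d0.
have [|t tb [tc ts]] := @circle_angle a s.
  by move: h; rewrite /SU2/= s2 => <-; ring.
pose n := (b + s) ^+ 2 + c ^+ 2 + d ^+ 2.
have n0 : 0 < n.
  rewrite /n -addrA ltr_wpDl ?sqr_ge0// lt_neqAle eq_sym cd0/=.
  by rewrite addr_ge0 ?sqr_ge0.
pose r := (Num.sqrt n)^-1.
have rn : r ^+ 2 * n = 1.
  by rewrite /r exprVn sqr_sqrtr ?ltW// mulVf// gt_eqF.
exists ((0, r * (b + s)), (r * c, r * d)), t; split=> //.
  by rewrite /SU2/= -rn /n; ring.
rewrite /su2_diag -tc -ts /su2_mul/=.
have e : r * s ^+ 2 = r * (b ^+ 2 + c ^+ 2 + d ^+ 2) by rewrite s2.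
by congr ((_, _), (_, _)); lra.
Qed.

End QuaternionAlgebra.

(** * The topological group SU(2) and words in two elements *)

Section SU2Group.
Variable R : realType.
Local Notation K := (set_type (@SU2 R)).
Implicit Types a b x y z g : K.

Definition SU2_mk (x : su2amb R) (h : SU2 x) : K := exist _ x (mem_set h).

Lemma SU2_val_mk (x : su2amb R) (h : SU2 x) : set_val (SU2_mk h) = x.
Proof. by []. Qed.

Lemma SU2_val_inj : injective (set_val : K -> su2amb R).
Proof. exact: val_inj. Qed.

Definition kmul x y : K := SU2_mk (SU2_mul (set_valP x) (set_valP y)).
Definition kinv x : K := SU2_mk (SU2_inv (set_valP x)).
Definition kone : K := SU2_mk (SU2_one R).
Definition kdiag t : K := SU2_mk (SU2_diag t).

Lemma kmulA x y z : kmul x (kmul y z) = kmul (kmul x y) z.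
Proof. by apply: SU2_val_inj; exact: su2_mulA. Qed.

Lemma kmul1 x : kmul x kone = x.
Proof. by apply: SU2_val_inj; exact: su2_mul1. Qed.

Lemma k1mul x : kmul kone x = x.
Proof. by apply: SU2_val_inj; exact: su2_1mul. Qed.

Lemma kmulV x : kmul x (kinv x) = kone.
Proof. by apply: SU2_val_inj; exact: su2_mulV (set_valP x). Qed.

Lemma kVmul x : kmul (kinv x) x = kone.
Proof. by apply: SU2_val_inj; exact: su2_Vmul (set_valP x). Qed.

Lemma kdiagD s t : kmul (kdiag s) (kdiag t) = kdiag (s + t).
Proof. by apply: SU2_val_inj; exact: su2_diagD. Qed.

Lemma kdiag0 : kdiag 0 = kone.
Proof. by apply: SU2_val_inj; exact: su2_diag0. Qed.

Lemma su2_mul_continuous (T : topologicalType) (f g : T -> su2amb R) :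
  continuous f -> continuous g -> continuous (fun t => su2_mul (f t) (g t)).
Proof.
move=> cf cg t.
have c1 (U V : topologicalType) (h : T -> U * V) :
    continuous h -> continuous (fun s => (h s).1).
  by move=> ch s; apply: (@continuous_comp _ _ _ h fst s); [exact: ch|exact: cvg_fst].
have c2 (U V : topologicalType) (h : T -> U * V) :
    continuous h -> continuous (fun s => (h s).2).
  by move=> ch s; apply: (@continuous_comp _ _ _ h snd s); [exact: ch|exact: cvg_snd].
have pr (U V : topologicalType) (h : T -> U) (k : T -> V) :
    {for t, continuous h} -> {for t, continuous k} ->
    {for t, continuous (fun s => (h s, k s))}.
  by move=> ch ck; exact: (@cvg_pair _ _ _ _ (nbhs (h t)) (nbhs (k t))).
have cM (u v : T -> R) : {for t, continuous u} -> {for t, continuous v} ->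
    {for t, continuous (fun s => u s * v s)} by exact: cvgM.
have cD (u v : T -> R) : {for t, continuous u} -> {for t, continuous v} ->
    {for t, continuous (fun s => u s + v s)} by exact: cvgD.
have cB (u v : T -> R) : {for t, continuous u} -> {for t, continuous v} ->
    {for t, continuous (fun s => u s - v s)} by exact: cvgB.
have a := c1 _ _ _ (c1 _ _ _ cf) t; have a' := c1 _ _ _ (c1 _ _ _ cg) t.
have b := c2 _ _ _ (c1 _ _ _ cf) t; have b' := c2 _ _ _ (c1 _ _ _ cg) t.
have c := c1 _ _ _ (c2 _ _ _ cf) t; have c' := c1 _ _ _ (c2 _ _ _ cg) t.
have d := c2 _ _ _ (c2 _ _ _ cf) t; have d' := c2 _ _ _ (c2 _ _ _ cg) t.
rewrite su2_mulE /=.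
exact: (pr _ _ _ _
  (pr _ _ _ _
    (cB _ _ (cB _ _ (cB _ _ (cM _ _ a a') (cM _ _ b b')) (cM _ _ c c')) (cM _ _ d d'))
    (cD _ _ (cB _ _ (cD _ _ (cM _ _ a b') (cM _ _ b a')) (cM _ _ c d')) (cM _ _ d c')))
  (pr _ _ _ _
    (cD _ _ (cD _ _ (cB _ _ (cM _ _ c a') (cM _ _ d b')) (cM _ _ a c')) (cM _ _ b d'))
    (cB _ _ (cD _ _ (cD _ _ (cM _ _ c b') (cM _ _ d a')) (cM _ _ a d')) (cM _ _ b c')))).
Qed.

Lemma kval_continuous : continuous (set_val : K -> su2amb R).
Proof. exact: initial_continuous. Qed.

Lemma kmul_continuous (T : topologicalType) (f g : T -> K) :
  continuous f -> continuous g -> continuous (fun t => kmul (f t) (g t)).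
Proof.
move=> cf cg; apply: continuous_comp_initial.
by apply: (@su2_mul_continuous T (set_val \o f) (set_val \o g)) => t;
  (apply: continuous_comp; [exact: cf || exact: cg|exact: kval_continuous]).
Qed.

Lemma kdiag_continuous : continuous kdiag.
Proof.
apply: continuous_comp_initial => t.
apply: (@cvg_pair _ _ _ _ (nbhs (cos t, sin t)) (nbhs (0 : R, 0 : R)));
  last exact: cvg_cst.
by apply: (@cvg_pair _ _ _ _ (nbhs (cos t)) (nbhs (sin t)));
  [exact: continuous_cos|exact: continuous_sin].
Qed.

Lemma SU2_rot t : SU2 (su2_rot (cos t : R) (sin t)).
Proof. by rewrite /SU2/= -[RHS](cos2Dsin2 t); ring. Qed.

Definition krot t : K := SU2_mk (SU2_rot t).

Lemma krot_continuous : continuous krot.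
Proof.
apply: continuous_comp_initial => t.
apply: (@cvg_pair _ _ _ _ (nbhs (cos t, 0 : R)) (nbhs (sin t, 0 : R))).
  apply: (@cvg_pair _ _ _ _ (nbhs (cos t)) (nbhs (0 : R))).
    exact: continuous_cos.
  exact: cvg_cst.
apply: (@cvg_pair _ _ _ _ (nbhs (sin t)) (nbhs (0 : R))).
  exact: continuous_sin.
exact: cvg_cst.
Qed.

(** Positive words in two letters: closure under products is what [torus_generates] asks of the set
    to be filled. *)
Inductive word := WE | WL | WR | WM of word & word.

Fixpoint weval w a b : K :=
  match w with
  | WE => kone
  | WL => a
  | WR => b
  | WM u v => kmul (weval u a b) (weval v a b)
  end.

Lemma weval_continuous w : continuous (fun p : K * K => weval w p.1 p.2).
Proof.
elim: w => [||| u hu v hv] /=.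
- exact: cst_continuous.
- by move=> p; exact: cvg_fst.
- by move=> p; exact: cvg_snd.
- exact: kmul_continuous.
Qed.

(** Inner conjugating factors cancel in pairs. This allows the first element of a pair to be taken
    diagonal. *)
Lemma weval_conj w g a b :
  weval w (kmul g (kmul a (kinv g))) (kmul g (kmul b (kinv g))) =
  kmul g (kmul (weval w a b) (kinv g)).
Proof.
elim: w => [||| u hu v hv] //=; first by rewrite k1mul kmulV.
by rewrite hu hv !kmulA -(kmulA _ (kinv g)) kVmul kmul1.
Qed.

Definition wpow j := iter j (WM WL) WE.

Lemma weval_pow j t b : weval (wpow j) (kdiag t) b = kdiag (t *+ j).
Proof.
elim: j => [|j ih] /=; first by rewrite mulr0n kdiag0.
by rewrite ih kdiagD mulrS.
Qed.

End SU2Group.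
Arguments weval {R}.

(** * Density of the pairs whose words meet an open set *)

Section Generation.
Variable R : realType.
Local Notation K := (set_type (@SU2 R)).
Implicit Types a b x y z g : K.

Definition kbeta2 x := su2_beta2 (set_val x).

(** The Euler decompositions of x and y share their middle factor, so only the outer angles have to
    be corrected. *)
Lemma kbeta2_biinvariant x y : kbeta2 x = kbeta2 y ->
  exists p q, y = kmul (kmul (kdiag p) x) (kdiag q).
Proof.
move=> xy; have [p [q hx]] := @su2_euler R (set_val x) (set_valP x).
have [p' [q' hy]] := @su2_euler R (set_val y) (set_valP y).
exists (p' - p), (q' - q); apply: SU2_val_inj.
change (set_val y =
  su2_mul (su2_mul (su2_diag (p' - p)) (set_val x)) (su2_diag (q' - q))).
rewrite [LHS]hy {1}hx -[su2_beta2 (set_val x)]/(kbeta2 x)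
  -[su2_beta2 (set_val y)]/(kbeta2 y) xy.
rewrite !su2_mulA su2_diagD -!su2_mulA su2_diagD.
by rewrite subrK [q + _]addrC subrK.
Qed.

Lemma beta2_rot_diag_rot (c s t : R) :
  su2_beta2 (su2_mul (su2_rot c s) (su2_mul (su2_diag t) (su2_rot c s))) =
  4 * s ^+ 2 * c ^+ 2 * cos t ^+ 2.
Proof. by rewrite /su2_beta2/=; ring. Qed.

(** This formula and the next serve to perturb elements at the two extreme values 0 and 1 of
    |beta|^2. *)
Lemma beta2_mul_rot0 (x : su2amb R) (c s : R) : SU2 x -> su2_beta2 x = 0 ->
  su2_beta2 (su2_mul x (su2_rot c s)) = s ^+ 2.
Proof.
case: x => [[x1 x2] [x3 x4]]; rewrite /SU2/su2_beta2/= => x1234 /eqP.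
rewrite paddr_eq0 ?sqr_ge0// !sqrf_eq0 => /andP[/eqP x30 /eqP x40].
rewrite x30 x40 expr0n/= !addr0 in x1234 *.
by transitivity ((x1 ^+ 2 + x2 ^+ 2) * s ^+ 2); [ring|rewrite x1234 mul1r].
Qed.

Lemma beta2_mul_rot1 (x : su2amb R) (c s : R) : SU2 x -> su2_beta2 x = 1 ->
  su2_beta2 (su2_mul x (su2_rot c s)) = c ^+ 2.
Proof.
case: x => [[x1 x2] [x3 x4]]; rewrite /SU2/su2_beta2/= -addrA => x1234 x34.
have /eqP : x1 ^+ 2 + x2 ^+ 2 = 0 by move: x1234; rewrite x34; lra.
rewrite paddr_eq0 ?sqr_ge0// !sqrf_eq0 => /andP[/eqP-> /eqP->].
by transitivity ((x3 ^+ 2 + x4 ^+ 2) * c ^+ 2); [ring|rewrite x34 mul1r].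
Qed.

(* With [s] the value of [|beta|^2] on a double coset of the diagonal torus [T],
   [R(rho) T R(rho)] meets every double coset of parameter at most [4 s (1 - s)];
   iterating, all parameters in [0, 1] are reached. *)
Lemma torus_generates (M : set K) b :
    (forall t, M (kdiag t)) -> (forall x y, M x -> M y -> M (kmul x y)) ->
    M b -> 0 < kbeta2 b < 1 ->
  forall y, M y.
Proof.
move=> Mdiag Mmul Mb b01.
have biinv x y : M x -> kbeta2 x = kbeta2 y -> M y.
  by move=> Mx /kbeta2_biinvariant[p [q ->]]; do 2 (apply: (Mmul) => //).
pose S s := exists2 x, M x & kbeta2 x = s.
have step s s' : S s -> 0 < s < 1 -> 0 <= s' <= 4 * s * (1 - s) -> S s'.
  move=> [x Mx xs] /andP[s0 s1] /andP[s'0 s's].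
  have [|r _ [rc rs]] := @circle_angle _ (Num.sqrt (1 - s)) (Num.sqrt s).
    by rewrite !sqr_sqrtr ?subrK// ?subr_ge0 ltW.
  have rs2 : sin r ^+ 2 = s by rewrite -rs sqr_sqrtr// ltW.
  have rc2 : cos r ^+ 2 = 1 - s by rewrite -rc sqr_sqrtr// subr_ge0 ltW.
  have Mr : M (krot r).
    by apply: (biinv x) => //; rewrite xs /kbeta2 /su2_beta2/= rs2 expr0n addr0.
  have d0 : 0 < 4 * s * (1 - s) by rewrite !mulr_gt0// subr_gt0.
  (* Chosen so that 4 s (1 - s) cos(t)^2 equals s'. *)
  pose t := acos (Num.sqrt (s' / (4 * s * (1 - s)))).
  have tc : cos t ^+ 2 = s' / (4 * s * (1 - s)).
    rewrite acosK ?sqr_sqrtr ?divr_ge0 ?(ltW d0)//.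
    rewrite in_itv/= (le_trans _ (sqrtr_ge0 _)) ?oppr_le0//=.
    by rewrite -[leRHS]sqrtr1 ler_wsqrtr// ler_pdivrMr// mul1r.
  exists (kmul (krot r) (kmul (kdiag t) (krot r))); first by do 2 apply: (Mmul) => //.
  by rewrite /kbeta2/= beta2_rot_diag_rot rs2 rc2 tc mulrC divfK// gt_eqF.
pose s0 := kbeta2 b; have Ss0 : S s0 by exists b.
have /andP[s00 s01] : 0 < s0 < 1 by [].
pose s1 := 4 * s0 * (1 - s0).
have s10 : 0 < s1 by rewrite !mulr_gt0// subr_gt0.
(* Each round doubles the range: from s / 2 all values up to 2 s (1 - s / 2) >= s are reached. The
   value 0 is taken from s0, since [step] needs a positive start. *)
have small n s : 0 <= s <= 2^-1 -> s <= 2 ^+ n * s1 -> S s.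
  elim: n s => [|n ih] s /andP[s_0 s_1].
    by rewrite mul1r => ss1; apply: (step s0); rewrite ?s_0.
  have [->|sn0] := eqVneq s 0.
    by move=> _; apply: (step s0); rewrite // lexx ltW.
  have s_gt0 : 0 < s by rewrite lt_neqAle eq_sym sn0.
  rewrite exprS => ss1; apply: (step (s / 2)).
  - have h : 0 <= s / 2 <= 2^-1 by apply/andP; split; lra.
    by apply: ih h _; lra.
  - by apply/andP; split; lra.
  - by apply/andP; split; nra.
have half : S 2^-1.
  apply: (small (Num.truncn s1^-1).+1); first by rewrite lexx andbT.
  have h1 := truncnS_gt s1^-1.
  have h2 : (Num.truncn s1^-1).+1%:R <= 2 ^+ (Num.truncn s1^-1).+1 :> R.
    by rewrite -natrX ler_nat ltnW// ltn_expl.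
  have : s1^-1 * s1 <= 2 ^+ (Num.truncn s1^-1).+1 * s1.
    by rewrite ler_pM2r// (le_trans _ h2)// ltW.
  by rewrite mulVf ?gt_eqF//; apply: le_trans; lra.
(* At parameter 1/2 the bound 4 s (1 - s) equals 1, so a single further step reaches everything. *)
move=> y; have [||x Mx xy] := step 2^-1 (kbeta2 y) half; first by lra.
- rewrite su2_beta2_ge0/=.
  have := @su2_beta2_le1 R (set_val y) (set_valP y); rewrite /kbeta2; lra.
- exact: biinv xy.
Qed.

(** The angles 2 pi k / p have spacing 2 pi / p, which is below the radius [eta] given by continuity
    as soon as p > 2 pi / eta. *)
Lemma root_of_unity_dense (t : R) (W : set K) : 0 <= t < pi *+ 2 ->
  nbhs (kdiag t) W -> exists N, forall p, (1 < p)%N -> (N <= p)%N ->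
  exists2 k, (0 < k < p)%N & W (kdiag (pi *+ 2 * k%:R / p%:R)).
Proof.
move=> /andP[t0 t2] /(@kdiag_continuous _ t)[eta /= eta0 etaW].
set tau : R := pi *+ 2 in t2 *.
have tau0 : 0 < tau by rewrite mulrn_wgt0 ?pi_gt0.
exists (Num.truncn (tau / eta)).+1 => p p1 Np.
have p0 : 0 < p%:R :> R by rewrite ltr0n ltnW.
have taup : tau / p%:R < eta.
  rewrite ltr_pdivrMr// mulrC -ltr_pdivrMr//.
  by rewrite (lt_le_trans (truncnS_gt _))// ler_nat.
have T0 : 0 <= t * p%:R / tau by rewrite divr_ge0 ?mulr_ge0 ?(ltW tau0) ?(ltW p0).
have /andP[k1 k2] := truncn_itv T0.
set k := Num.truncn _ in k1 k2.
have kp : (k < p)%N.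
  rewrite -(ltr_nat R) (le_lt_trans k1)// ltr_pdivrMr// mulrC.
  by rewrite ltr_pM2l.
exists (maxn 1 k); first by rewrite gtn_max p1 kp leq_max.
apply: etaW; rewrite /ball_/= distrC.
apply: le_lt_trans taup.
have e1 : tau * k%:R / p%:R <= t.
  by move: k1; rewrite ler_pdivlMr// => k1; rewrite ler_pdivrMr// mulrC.
have e2 : t <= tau * k%:R / p%:R + tau / p%:R.
  move/ltW: k2; rewrite ler_pdivrMr// -natr1 => k2.
  by rewrite -mulrDl ler_pdivlMr//; lra.
have := divr_ge0 (ltW tau0) (ltW p0).
case: (posnP k) => [k0|kgt0].
  rewrite k0 /= mulr0 mul0r add0r in e2; rewrite k0 maxn0 mulr1.
  by move=> ?; rewrite ler_norml; lra.
by rewrite (maxn_idPr kgt0) => ?; rewrite ler_norml; lra.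
Qed.

(** The threshold [N] is uniform in [p] and [k], while the word may depend on both. Hence the root
    of unity may be chosen afterwards, close to a prescribed diagonal matrix. *)
Definition word_limit b y := forall W, nbhs y W -> exists N, forall p k,
  prime p -> (N <= p)%N -> (0 < k < p)%N ->
  exists w, W (weval w (kdiag (pi *+ 2 * k%:R / p%:R)) b).

(** For prime p and 0 < k < p the root of unity is primitive, so its powers run through all p-th
    roots of unity, one of which is close to the target. *)
Lemma word_limit_diag b t : word_limit b (kdiag t).
Proof.
have [u ub [uc us]] := circle_angle (cos2Dsin2 t).
have -> : kdiag t = kdiag u.
  by apply: SU2_val_inj; rewrite !SU2_val_mk /su2_diag uc us.
move=> W /(root_of_unity_dense ub)[N HN]; exists N => p k pp Np /andP[k0 kp].
have [m /andP[m0 mp] Wm] := HN p (prime_gt1 pp) Np.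
have cop : coprime k p by rewrite coprime_sym prime_coprime// gtnNdvd.
(* Bezout gives u' k = v' p + 1, so the power u' m turns the angle 2 pi k / p into 2 pi m / p up to
   a multiple of 2 pi. *)
case: (@egcdnP k p k0) => u' v' E _; rewrite (eqP cop) in E.
exists (wpow (u' * m)); rewrite weval_pow.
rewrite (_ : kdiag _ = kdiag (pi *+ 2 * m%:R / p%:R)) //.
have p0 : p%:R != 0 :> R by rewrite pnatr_eq0 -lt0n prime_gt0.
have -> : pi *+ 2 * k%:R / p%:R *+ (u' * m) =
    pi *+ 2 * m%:R / p%:R + pi *+ 2 *+ (v' * m) :> R.
  rewrite -mulr_natr natrM.
  have : u'%:R * k%:R = v'%:R * p%:R + 1 :> R by rewrite -!natrM E natrD.
  move=> E'.
  transitivity (pi *+ 2 * m%:R / p%:R * (u'%:R * k%:R) : R); first by ring.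
  by rewrite E' -[_ *+ (v' * m)]mulr_natr natrM; field.
apply: SU2_val_inj; rewrite !SU2_val_mk /su2_diag.
by rewrite (periodicn (@cosD2pi R)) (periodicn (@sinD2pi R)).
Qed.

Lemma word_limit_mul b x y :
  word_limit b x -> word_limit b y -> word_limit b (kmul x y).
Proof.
move=> hx hy W.
move=> /(@kmul_continuous R _ fst snd (fun p => cvg_fst) (fun p => cvg_snd) (x, y)).
case=> -[A B] /= [/hx[N HN] /hy[N' HN']] AB.
exists (maxn N N') => p k pp; rewrite geq_max => /andP[Np N'p] kp.
have [w wA] := HN p k pp Np kp; have [w' wB] := HN' p k pp N'p kp.
by exists (WM w w'); exact: (AB (_, _)).
Qed.

(** The word limits contain the torus and b and are closed under products, so [torus_generates]
    applies to them. *)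
Lemma word_limitT b : 0 < kbeta2 b < 1 -> forall y, word_limit b y.
Proof.
move=> b01; apply: (torus_generates (b := b)) b01.
- exact: word_limit_diag.
- exact: word_limit_mul.
- by move=> W /nbhs_singleton Wb; exists 0%N => *; exists WR.
Qed.

(** Multiplication by a small rotation of angle r moves |beta|^2 from 0 to sin(r)^2 and from 1 to
    cos(r)^2. *)
Lemma kbeta2_perturb b (W : set K) : nbhs b W ->
  exists2 b', W b' & 0 < kbeta2 b' < 1.
Proof.
move=> Wb; have [b01|] := boolP (0 < kbeta2 b < 1).
  by exists b => //; exact: nbhs_singleton.
move=> b01.
have b0' := su2_beta2_ge0 (set_val b); have b1' := @su2_beta2_le1 R (set_val b) (set_valP b).
rewrite -/(kbeta2 b) in b0' b1'.
have /(_ 0) : continuous (fun t => kmul b (krot t)).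
  by apply: kmul_continuous; [exact: cst_continuous|exact: krot_continuous].
rewrite /continuous_at (_ : kmul b (krot 0) = b); last first.
  rewrite (_ : krot 0 = kone R) ?kmul1//.
  by apply: SU2_val_inj; rewrite !SU2_val_mk /su2_rot cos0 sin0.
move=> /(_ _ Wb)[eta /= eta0 etaW].
have pi0 := pi_gt0 R.
(* The first bound keeps r inside the neighbourhood, the second keeps both sin r and cos r
   positive. *)
pose r : R := Num.min (eta / 2) (pi / 4).
have r0 : 0 < r by rewrite lt_min !divr_gt0.
have [r1 r2] : r <= eta / 2 /\ r <= pi / 4.
  by rewrite !ge_min !lexx orbT.
exists (kmul b (krot r)).
  by apply: etaW; rewrite /ball_/= sub0r normrN gtr0_norm//; lra.
have rc : 0 < cos r by apply: cos_gt0_pihalf; apply/andP; split; lra.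
have rs : 0 < sin r by apply: sin_gt0_pi; apply/andP; split; lra.
have cs := cos2Dsin2 r; have c2 := exprn_gt0 2 rc; have s2 := exprn_gt0 2 rs.
have [e|e] : kbeta2 b = 0 \/ kbeta2 b = 1.
- have [->|bn0] := eqVneq (kbeta2 b) 0; first by left.
  right; apply/eqP; rewrite eq_le b1' leNgt; apply: contra b01 => ->.
  by rewrite lt_neqAle eq_sym bn0 b0'.
- by rewrite /kbeta2 (beta2_mul_rot0 _ _ (set_valP b) e); apply/andP; split; lra.
- by rewrite /kbeta2 (beta2_mul_rot1 _ _ (set_valP b) e); apply/andP; split; lra.
Qed.

(* Raising [a = g diag(t) g^-1] to a root of unity of large prime order near
   [t], its powers fill the torus up to small error, while the perturbed [b]
   stays fixed. *)
Lemma words_meet_open (U V : set (K * K)) :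
  open U -> open V -> U !=set0 -> V !=set0 ->
  exists2 p, V p & exists w w', U (weval w p.1 p.2, weval w' p.1 p.2).
Proof.
move=> oU oV [[y1 y2] Uy] [[a0 b0] Vab].
have [g [t [hg tb a0g]]] := @su2_diagonalize R (set_val a0) (set_valP a0).
pose h := SU2_mk hg; pose cj (p : K * K) : K * K :=
  (kmul h (kmul p.1 (kinv h)), kmul h (kmul p.2 (kinv h))).
have cj_cont : continuous cj.
  have cc (f : K * K -> K) : continuous f ->
      continuous (fun p => kmul h (kmul (f p) (kinv h))).
    move=> cf; apply: kmul_continuous; first exact: cst_continuous.
    by apply: kmul_continuous; [exact: cf|exact: cst_continuous].
  move=> p; apply: (@cvg_pair _ _ _ _ (nbhs (cj p).1) (nbhs (cj p).2)).
    by apply: (cc fst) => q; exact: cvg_fst.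
  by apply: (cc snd) => q; exact: cvg_snd.
have cjK x : kmul h (kmul (kmul (kinv h) (kmul x h)) (kinv h)) = x.
  by rewrite !kmulA kmulV k1mul -kmulA kmulV kmul1.
have a0E : a0 = kmul h (kmul (kdiag t) (kinv h)).
  have e : kmul a0 h = kmul h (kdiag t) by exact: SU2_val_inj.
  by rewrite kmulA -e -kmulA kmulV kmul1.
pose b1 := kmul (kinv h) (kmul b0 h).
have : nbhs (kdiag t, b1) (cj @^-1` V).
  by apply: cj_cont; apply: open_nbhs_nbhs; split=> //; rewrite /cj/= -a0E cjK.
case=> -[A B] /= [tA b1B] AB.
have [b Bb b01] := kbeta2_perturb b1B.
have [N0 HN0] := root_of_unity_dense tb tA.
(* The target is conjugated as well, since words evaluated at the conjugated pair are conjugates of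
   words at the diagonal one. *)
have : nbhs (kmul (kinv h) (kmul y1 h), kmul (kinv h) (kmul y2 h)) (cj @^-1` U).
  by apply: cj_cont; apply: open_nbhs_nbhs; split=> //; rewrite /cj/= !cjK.
case=> -[C D] /= [y1C y2D] CD.
have [N1 HN1] := word_limitT b01 y1C; have [N2 HN2] := word_limitT b01 y2D.
(* One prime beyond all three thresholds; then k is picked near t, and only then the two words. *)
have [p pN pp] := prime_above (N0 + N1 + N2).
have [||k kp Ak] := HN0 p; [exact: prime_gt1|by lia|].
have [|w wC] := HN1 p k pp _ kp; first by lia.
have [|w' wD] := HN2 p k pp _ kp; first by lia.
exists (cj (kdiag (pi *+ 2 * k%:R / p%:R), b)); first exact: (AB (_, _)).
by exists w, w'; rewrite /cj/= !weval_conj; exact: (CD (_, _)).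
Qed.

End Generation.

(** * Displacement functions of the regular representation *)

Section RegularRepresentation.
Variables (R : realType) (mu : probability (su2amb R) R).
Hypothesis haar : is_haar mu.
Implicit Types (g x y : su2amb R) (f : su2amb R -> R).
Local Notation SU2 := (@SU2 R).

Lemma measurable_coord :
  [/\ measurable_fun setT (fun x => x.1.1), measurable_fun setT (fun x => x.1.2),
      measurable_fun setT (fun x => x.2.1) & measurable_fun setT (fun x => x.2.2)].
Proof.
by split; apply: measurableT_comp => //; exact: measurable_fst || exact: measurable_snd.
Qed.

Lemma measurable_SU2 : measurable SU2.
Proof.
have [m1 m2 m3 m4] := measurable_coord.
rewrite -[SU2]setTI.
apply: (_ : measurable_fun setT (fun x : su2amb R =>
  x.1.1 ^+ 2 + x.1.2 ^+ 2 + x.2.1 ^+ 2 + x.2.2 ^+ 2)) (measurableT) [set 1] _ => //.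
by repeat apply: measurable_funD; apply: measurable_funX.
Qed.
Local Hint Resolve measurable_SU2 : core.

Lemma measurable_su2_mul g : measurable_fun setT (su2_mul g).
Proof.
have [m1 m2 m3 m4] := measurable_coord.
have mc (c : R) h : measurable_fun setT h -> measurable_fun setT (fun x => c * h x).
  by move=> mh; apply: measurable_funM.
rewrite su2_mulE; apply: measurable_fun_pair; apply: measurable_fun_pair => /=.
- by do 3 (apply: measurable_funB; last exact: mc); exact: mc.
- apply: measurable_funD; last exact: mc.
  by apply: measurable_funB; last exact: mc; apply: measurable_funD; exact: mc.
- by do 2 (apply: measurable_funD; last exact: mc); apply: measurable_funB; exact: mc.
- apply: measurable_funB; last exact: mc.
  by do 2 (apply: measurable_funD; last exact: mc); exact: mc.
Qed.


Lemma haar_preimage g (A : set (su2amb R)) : SU2 g -> measurable A ->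
  mu (SU2 `&` su2_mul g @^-1` A) = mu (SU2 `&` A).
Proof.
move=> gK mA; have := haar.2 _ (SU2_inv gK) _ mA.
by rewrite su2_invK.
Qed.

Lemma measurable_fun_translate g f : SU2 g ->
  measurable_fun SU2 f -> measurable_fun SU2 (f \o su2_mul g).
Proof.
move=> gK mf; apply: (measurable_comp (F := SU2)) => //.
  by move=> _ [x xK <-]; exact: SU2_mul.
exact: measurable_funTS (measurable_su2_mul g).
Qed.

(** Translation by g maps SU(2) onto itself and pushes [mu] forward to a measure that agrees with
    [mu] on measurable subsets of SU(2). *)
Lemma ge0_integral_translate g (f : su2amb R -> \bar R) : SU2 g ->
  measurable_fun SU2 f -> (forall x, SU2 x -> 0 <= f x)%E ->
  (\int[mu]_(x in SU2) f (su2_mul g x) = \int[mu]_(x in SU2) f x)%E.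
Proof.
move=> gK mf f0.
have preK : su2_mul g @^-1` SU2 = SU2.
  by apply/seteqP; split=> x /(SU2_mulr x gK).
have f0' : {in SU2, forall x, (0 <= f x)%E} by move=> x /set_mem; exact: f0.
have := ge0_integral_pushforward (measurable_su2_mul g) mu measurable_SU2 mf f0'.
rewrite preK /= => <-; apply: eq_measure_integral => [|mphi A mA AK];
  first exact: measurable_su2_mul.
transitivity (mu (SU2 `&` A)); last by rewrite setIidr.
rewrite -(haar_preimage gK mA) setIidr//.
by move=> x /AK /(SU2_mulr x gK).
Qed.

(** * Squared norms and squared displacements of real functions *)

Definition L2 f :=
  measurable_fun SU2 f /\ mu.-integrable SU2 (fun x => (f x ^+ 2)%:E).

Definition energy f : R := fine (\int[mu]_(x in SU2) (f x ^+ 2)%:E)%E.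

Definition displacement f g := energy (fun h => lreg g f h - f h).

Lemma measurable_sqr f : measurable_fun SU2 f ->
  measurable_fun SU2 (fun x => (f x ^+ 2)%:E).
Proof. by move=> mf; apply/measurable_EFinP; exact: measurable_funX. Qed.

Lemma sqr_ge0_EFin (r : R) : (0 <= (r ^+ 2)%:E)%E.
Proof. by rewrite lee_fin sqr_ge0. Qed.
Local Hint Resolve sqr_ge0_EFin : core.

Lemma energyE f : L2 f -> (\int[mu]_(x in SU2) (f x ^+ 2)%:E = (energy f)%:E)%E.
Proof. by move=> [mf fi]; rewrite fineK//; exact: integrable_fin_num. Qed.

Lemma energy_ge0 f : 0 <= energy f.
Proof. by rewrite fine_ge0// integral_ge0. Qed.

Lemma eq_energy f1 f2 : {in SU2, f1 =1 f2} -> energy f1 = energy f2.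
Proof.
by move=> f12; congr fine; apply: eq_integral => x xK; rewrite f12.
Qed.

Lemma L2_le f1 f2 : measurable_fun SU2 f1 -> L2 f2 ->
  (forall x, SU2 x -> f1 x ^+ 2 <= f2 x ^+ 2) -> L2 f1.
Proof.
move=> mf1 [mf2 f2i] f12; split=> //; apply: le_integrable f2i => //.
  exact: measurable_sqr.
by move=> x xK; rewrite !gee0_abs// lee_fin f12.
Qed.

Lemma le_energy f1 f2 : measurable_fun SU2 f1 -> L2 f2 ->
  (forall x, SU2 x -> f1 x ^+ 2 <= f2 x ^+ 2) -> energy f1 <= energy f2.
Proof.
move=> mf1 Lf2 f12; have Lf1 := L2_le mf1 Lf2 f12.
rewrite -lee_fin -!energyE//; case: Lf2 => mf2 _.
by apply: ge0_le_integral => //; exact: measurable_sqr.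
Qed.

Lemma L2_cst c : L2 (cst c).
Proof.
split; first exact: measurable_cst.
apply/integrableP; split.
  by apply: measurable_sqr; exact: measurable_cst.
rewrite /= integral_cst//= haar.1 mule1; exact: ltry.
Qed.

Lemma energy_cst c : energy (cst c) = c ^+ 2.
Proof.
by rewrite /energy /= integral_cst//= haar.1 mule1.
Qed.

Lemma L2Z c f : L2 f -> L2 (fun x => c * f x).
Proof.
move=> [mf fi]; split; first exact: measurable_funM.
apply: eq_integrable (integrableZl measurable_SU2 (c ^+ 2) fi) => // x _.
by rewrite -EFinM exprMn.
Qed.

Lemma energyZ c f : L2 f -> energy (fun x => c * f x) = c ^+ 2 * energy f.
Proof.
move=> Lf; apply: EFin_inj; rewrite -energyE; last exact: L2Z.
rewrite EFinM -energyE//; case: Lf => mf _.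
rewrite -ge0_integralZl//; last exact: measurable_sqr.
by apply: eq_integral => x _; rewrite -EFinM exprMn.
Qed.

Lemma L2D f1 f2 : L2 f1 -> L2 f2 -> L2 (fun x => f1 x + f2 x).
Proof.
move=> [mf1 f1i] [mf2 f2i]; split; first exact: measurable_funD.
have := integrableZl measurable_SU2 2 (integrableD measurable_SU2 f1i f2i).
apply: le_integrable => //; first by apply: measurable_sqr; exact: measurable_funD.
move=> x _; rewrite !gee0_abs//= -?EFinD -?EFinM lee_fin;
  do ?[exact: sqr_ge0|by rewrite mulr_ge0// addr_ge0// ?sqr_ge0].
by have := sqr_ge0 (f1 x - f2 x); nra.
Qed.

(** Integrated form of (a + b)^2 <= 2 (a^2 + b^2); it replaces the triangle inequality for squared
    norms. *)
Lemma energyD f1 f2 : L2 f1 -> L2 f2 ->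
  energy (fun x => f1 x + f2 x) <= 2 * (energy f1 + energy f2).
Proof.
move=> L1 L2'; rewrite -lee_fin -energyE; last exact: L2D.
rewrite EFinM (EFinD (energy f1)) -(energyE L1) -(energyE L2').
case: L1 => mf1 _; case: L2' => mf2 _.
rewrite -ge0_integralD//; try exact: measurable_sqr.
rewrite -ge0_integralZl//; last 2 first.
- by apply: emeasurable_funD; exact: measurable_sqr.
- by move=> x _; rewrite adde_ge0.
apply: ge0_le_integral => //.
- exact: (measurable_sqr (f := fun x => f1 x + f2 x) (measurable_funD mf1 mf2)).
- by apply: measurable_funeM; apply: emeasurable_funD; exact: measurable_sqr.
- move=> x _; rewrite -EFinD -EFinM lee_fin.
  by have := sqr_ge0 (f1 x - f2 x); nra.
Qed.

Lemma L2B f1 f2 : L2 f1 -> L2 f2 -> L2 (fun x => f1 x - f2 x).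
Proof.
move=> h1 h2; rewrite (_ : (fun _ => _) = fun x => f1 x + -1 * f2 x).
  by apply: L2D => //; exact: L2Z.
by apply/funext => x; rewrite mulN1r.
Qed.

Lemma energyN f : energy (fun x => - f x) = energy f.
Proof. by congr fine; apply: eq_integral => x _; rewrite sqrrN. Qed.

Lemma L2_lreg g f : SU2 g -> L2 f -> L2 (lreg g f).
Proof.
move=> /SU2_inv gK [mf fi]; have mfg := measurable_fun_translate gK mf.
split=> //; apply/integrableP; split; first exact: measurable_sqr.
move/integrableP : fi => [m]; congr (_ < _)%E; apply/esym.
under eq_integral do rewrite gee0_abs//.
under [RHS]eq_integral do rewrite gee0_abs//.
exact: (ge0_integral_translate (f := fun x => (f x ^+ 2)%:E)).
Qed.

Lemma energy_lreg g f : SU2 g -> L2 f -> energy (lreg g f) = energy f.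
Proof.
move=> /SU2_inv gK [mf fi]; congr fine.
by apply: (ge0_integral_translate (f := fun x => (f x ^+ 2)%:E)) => //; exact: measurable_sqr.
Qed.

(** Write the difference for xy as the translate by x of the difference for y, plus the difference
    for x; translation preserves the energy. *)
Lemma displacement_mul f x y : SU2 x -> SU2 y -> L2 f ->
  displacement f (su2_mul x y) <= 2 * (displacement f y + displacement f x).
Proof.
move=> xK yK Lf; have Ly := L2B (L2_lreg yK Lf) Lf.
rewrite -[displacement f y](energy_lreg xK)//.
apply: le_trans (energyD (L2_lreg xK Ly) (L2B (L2_lreg xK Lf) Lf)).
rewrite le_eqVlt; apply/orP; left; apply/eqP; apply: eq_energy => h _.
by rewrite /lreg su2_invM su2_mulA; ring.
Qed.

End RegularRepresentation.

(** * Strong continuity of the regular representation *)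

Section StrongContinuity.
Variables (R : realType) (mu : probability (su2amb R) R).
Hypothesis haar : is_haar mu.
Implicit Types (g x y : su2amb R) (f : su2amb R -> R).
Local Notation SU2 := (@SU2 R).
Local Notation L2 := (L2 mu).
Local Notation energy := (energy mu).
Local Notation displacement := (displacement mu).
Local Hint Resolve measurable_SU2 : core.
Import HBNNSimple.

(** Continuity of the orbit map at the identity, along SU(2) inside R^4. Continuity at other points
    is later recovered by translation. *)
Definition continuous_orbit f := L2 f /\ forall eta : R, 0 < eta ->
  \forall g \near su2_one R, SU2 g -> displacement f g <= eta.

Lemma continuous_orbit_cst c : continuous_orbit (cst c).
Proof.
split=> [|eta eta0]; first exact: L2_cst.
near=> g => _; rewrite /displacement (eq_energy mu (f2 := cst 0)).
  by rewrite energy_cst// expr0n ltW.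
by move=> x _; rewrite /lreg/= subrr.
Unshelve. all: by end_near. Qed.

Lemma continuous_orbitZ c f : continuous_orbit f ->
  continuous_orbit (fun x => c * f x).
Proof.
move=> [Lf cf]; split=> [|eta eta0]; first exact: L2Z.
(* Adding 1 keeps the denominator positive even when c = 0. *)
have c20 : 0 < c ^+ 2 + 1 by rewrite ltr_wpDl ?sqr_ge0.
near=> g.
have gd : SU2 g -> displacement f g <= eta / (c ^+ 2 + 1).
  by near: g; apply: cf; rewrite divr_gt0.
move=> gK; move: (gd gK) => {}gd.
rewrite /displacement (eq_energy mu (f2 := fun h => c * (lreg g f h - f h))); last first.
  by move=> x _; rewrite /lreg mulrBr.
rewrite energyZ; last by apply: L2B => //; exact: L2_lreg.
rewrite -/(displacement f g).
have d0 : 0 <= displacement f g by exact: energy_ge0.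
by move: gd; rewrite ler_pdivlMr//; nra.
Unshelve. all: by end_near. Qed.

Lemma continuous_orbitD f1 f2 : continuous_orbit f1 -> continuous_orbit f2 ->
  continuous_orbit (fun x => f1 x + f2 x).
Proof.
move=> [L1 c1] [L2' c2]; split=> [|eta eta0]; first exact: L2D.
near=> g.
have g1 : SU2 g -> displacement f1 g <= eta / 4 by near: g; apply: c1; rewrite divr_gt0.
have g2 : SU2 g -> displacement f2 g <= eta / 4 by near: g; apply: c2; rewrite divr_gt0.
move=> gK; move: (g1 gK) (g2 gK) => {}g1 {}g2.
rewrite /displacement (eq_energy mu
  (f2 := fun h => (lreg g f1 h - f1 h) + (lreg g f2 h - f2 h))); last first.
  by move=> x _; rewrite /lreg; ring.
apply: le_trans (energyD _ _) _; try by apply: L2B => //; exact: L2_lreg.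
by rewrite -/(displacement f1 g) -/(displacement f2 g); lra.
Unshelve. all: by end_near. Qed.

(** Leibniz rule: the difference for the product splits into two terms, each a difference for one
    factor times a function bounded by 1. *)
Lemma continuous_orbitM f1 f2 :
  (forall x, -1 <= f1 x <= 1) -> (forall x, -1 <= f2 x <= 1) ->
  continuous_orbit f1 -> continuous_orbit f2 ->
  continuous_orbit (fun x => f1 x * f2 x).
Proof.
move=> b1 b2 [L1 c1] [L2' c2].
have sq1 (r : R) : -1 <= r <= 1 -> r ^+ 2 <= 1 by move=> /andP[? ?]; nra.
have Lm f f' : (forall x, -1 <= f x <= 1) -> measurable_fun SU2 f -> L2 f' ->
    L2 (fun x => f x * f' x).
  move=> fb mf Lf'; apply: (L2_le _ Lf'); first by apply: measurable_funM => //; exact: Lf'.1.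
  move=> x _; rewrite exprMn.
  by have := sq1 _ (fb x); have := sqr_ge0 (f' x); nra.
split=> [|eta eta0]; first exact: Lm L1.1 L2'.
near=> g.
have g1 : SU2 g -> displacement f1 g <= eta / 4 by near: g; apply: c1; rewrite divr_gt0.
have g2 : SU2 g -> displacement f2 g <= eta / 4 by near: g; apply: c2; rewrite divr_gt0.
move=> gK; move: (g1 gK) (g2 gK) => {}g1 {}g2.
have M1 := L2B (L2_lreg haar gK L1) L1.
have M2 := L2B (L2_lreg haar gK L2') L2'.
have b2' x : -1 <= lreg g f2 x <= 1 by exact: b2.
have P1 := Lm _ _ b2' (L2_lreg haar gK L2').1 M1.
have P2 := Lm _ _ b1 L1.1 M2.
rewrite /displacement (eq_energy mu (f2 := fun h =>
  lreg g f2 h * (lreg g f1 h - f1 h) + f1 h * (lreg g f2 h - f2 h))); last first.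
  by move=> x _; rewrite /lreg; ring.
apply: le_trans (energyD P1 P2) _.
have e1 : energy (fun h => lreg g f2 h * (lreg g f1 h - f1 h)) <= displacement f1 g.
  apply: (le_energy P1.1 M1) => x _; rewrite exprMn.
  by have := sq1 _ (b2' x); have := sqr_ge0 (lreg g f1 x - f1 x); nra.
have e2 : energy (fun h => f1 h * (lreg g f2 h - f2 h)) <= displacement f2 g.
  apply: (le_energy P2.1 M2) => x _; rewrite exprMn.
  by have := sq1 _ (b1 x); have := sqr_ge0 (lreg g f2 x - f2 x); nra.
by lra.
Unshelve. all: by end_near. Qed.

(** Split the difference for f into the translate of f - s, the difference for s, and -(f - s); the
    outer two are small uniformly in g. *)
Lemma continuous_orbit_closed f : L2 f ->
  (forall eta : R, 0 < eta -> exists2 s, continuous_orbit s &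
     energy (fun x => f x - s x) <= eta) ->
  continuous_orbit f.
Proof.
move=> Lf fs; split=> // eta eta0.
(* Two nested uses of [energyD] cost a factor 2 (1 + 2 (1 + 1)) = 10, below 12. *)
have [|s [Ls cs] es] := fs (eta / 12); first by rewrite divr_gt0.
near=> g.
have gs : SU2 g -> displacement s g <= eta / 12 by near: g; apply: cs; rewrite divr_gt0.
move=> gK; move: (gs gK) => {}gs.
have Lfs := L2B Lf Ls; have Lgfs := L2_lreg haar gK Lfs.
have Lgs := L2B (L2_lreg haar gK Ls) Ls.
rewrite /displacement (eq_energy mu (f2 := fun h =>
   lreg g (fun x => f x - s x) h + ((lreg g s h - s h) + - (f h - s h)))); last first.
  by move=> x _; rewrite /lreg; ring.
have LN : L2 (fun h => - (f h - s h)).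
  by apply: (L2_le _ Lfs) => [|x _]; [apply: measurable_funN; exact: Lfs.1|rewrite sqrrN].
apply: le_trans (energyD Lgfs (L2D Lgs LN)) _.
have := energyD Lgs LN; rewrite energy_lreg// (energyN mu (fun h => f h - s h)).
rewrite -/(displacement s g); lra.
Unshelve. all: by end_near. Qed.

(** Since 0 <= s_n <= f, the squares (f - s_n)^2 are dominated by f^2, and dominated convergence
    yields approximation in norm. *)
Lemma continuous_orbit_lim (s_ : (su2amb R -> R)^nat) f :
  (forall n, continuous_orbit (s_ n)) -> L2 f ->
  (forall n x, SU2 x -> 0 <= s_ n x <= f x) ->
  (forall x, SU2 x -> s_ ^~ x @ \oo --> f x) ->
  continuous_orbit f.
Proof.
move=> cs Lf sf s_cvg; apply: continuous_orbit_closed => // eta eta0.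
pose F n x := ((f x - s_ n x) ^+ 2)%:E.
have mF n : measurable_fun SU2 (F n).
  by apply: (measurable_sqr (f := fun x => f x - s_ n x));
    apply: measurable_funB; [exact: Lf.1|exact: (cs n).1.1].
have [||||_ + _] := @dominated_convergence _ _ _ mu SU2 (@measurable_SU2 R) F
    (cst 0%E) (fun x => (f x ^+ 2)%:E) mF.
- exact: measurable_cst.
- apply: aeW => x xK; apply: cvg_EFin; first by apply: nearW.
  rewrite /= [X in _ --> X](_ : _ = (f x - f x) ^+ 2); last by rewrite subrr expr0n.
  have h : (fun n => f x - s_ n x) @ \oo --> f x - f x.
    by apply: cvgB; [exact: cvg_cst|exact: s_cvg].
  by apply: cvgM.
- exact: Lf.2.
- apply: aeW => x n xK; rewrite gee0_abs ?lee_fin ?sqr_ge0//.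
  by have /andP[] := sf n x xK; nra.
rewrite (_ : [sequence _]_n = fun n => (energy (fun x => f x - s_ n x))%:E); last first.
  apply/funext => n /=; rewrite -energyE; last exact: L2B Lf (cs n).1.
  by apply: eq_integral => x _ /=; rewrite subr0 ger0_norm ?sqr_ge0.
move=> /fine_cvg/cvgrPdist_le/(_ _ eta0)[N _ /(_ N (leqnn _))] /=.
rewrite sub0r normrN ger0_norm ?energy_ge0// => h.
by exists (s_ N).
Qed.

(** * Lipschitz functions on SU(2) *)

Lemma SU2_coord_le1 x : SU2 x ->
  [/\ -1 <= x.1.1 <= 1, -1 <= x.1.2 <= 1, -1 <= x.2.1 <= 1 & -1 <= x.2.2 <= 1].
Proof.
case: x => [[a b] [c d]]; rewrite /SU2/= => h.
have := sqr_ge0 a; have := sqr_ge0 b; have := sqr_ge0 c; have := sqr_ge0 d => *.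
by split; apply/andP; split; nra.
Qed.

Definition su2_dist1 g : R := `|g.1.1 - 1| + `|g.1.2| + `|g.2.1| + `|g.2.2|.

Lemma su2_dist1_small (rho : R) : 0 < rho ->
  \forall g \near su2_one R, su2_dist1 g <= rho.
Proof.
move=> rho0; have r4 : 0 < rho / 4 by rewrite divr_gt0.
exists ([set p : R * R | `|p.1 - 1| <= rho / 4 /\ `|p.2| <= rho / 4],
        [set p : R * R | `|p.1| <= rho / 4 /\ `|p.2| <= rho / 4]) => /=.
  have near0 (c : R) : nbhs c [set r | `|r - c| <= rho / 4].
    by exists (rho / 4) => //= r; rewrite /ball_/= distrC => /ltW.
  have near00 : nbhs (0 : R) [set r | `|r| <= rho / 4].
    by have := near0 0; congr (nbhs _ _); apply/funext => r /=; rewrite subr0.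
  split; [exists ([set r | `|r - 1| <= rho / 4], [set r | `|r| <= rho / 4])
         |exists ([set r | `|r| <= rho / 4], [set r | `|r| <= rho / 4])];
    by [|move=> [? ?] []].
move=> [[a b] [c d]] /= [[? ?] [? ?]]; rewrite /su2_dist1/=; lra.
Qed.

Lemma lipschitz4 (a b c d p q r s : R) :
  -1 <= p <= 1 -> -1 <= q <= 1 -> -1 <= r <= 1 -> -1 <= s <= 1 ->
  `|a * p + b * q + c * r + d * s| <= `|a| + `|b| + `|c| + `|d|.
Proof.
move=> hp hq hr hs.
have le (u v : R) : -1 <= v <= 1 -> `|u * v| <= `|u|.
  by rewrite -ler_norml normrM => v1; rewrite ler_piMr.
do 3 (apply: le_trans (ler_normD _ _) _; apply: lerD; last exact: le).
exact: le.
Qed.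

(** The difference is (g^-1 - 1) h, bilinear in the coordinates of g^-1 - 1 and of h, and the latter
    lie in [-1, 1]. *)
Lemma coord_translate g h : SU2 h ->
  let h' := su2_mul (su2_inv g) h in
  [/\ `|h'.1.1 - h.1.1| <= su2_dist1 g, `|h'.1.2 - h.1.2| <= su2_dist1 g,
      `|h'.2.1 - h.2.1| <= su2_dist1 g & `|h'.2.2 - h.2.2| <= su2_dist1 g].
Proof.
move=> /SU2_coord_le1; case: g => [[a b] [c d]]; case: h => [[p q] [r s]] /=.
move=> [hp hq hr hs]; rewrite /su2_dist1/=.
have N (v : R) : -1 <= v <= 1 -> -1 <= - v <= 1 by move=> /andP[? ?]; apply/andP; split; lra.
split.
- rewrite (_ : _ - _ = (a - 1) * p + b * q + c * r + d * s); last by ring.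
  exact: lipschitz4.
- rewrite (_ : _ - _ = (a - 1) * q + b * (- p) + c * s + d * (- r)); last by ring.
  by apply: lipschitz4 => //; exact: N.
- rewrite (_ : _ - _ = (a - 1) * r + b * (- s) + c * (- p) + d * q); last by ring.
  by apply: lipschitz4 => //; exact: N.
- rewrite (_ : _ - _ = (a - 1) * s + b * r + c * (- q) + d * (- p)); last by ring.
  by apply: lipschitz4 => //; exact: N.
Qed.

Lemma continuous_orbit_lipschitz f (L M : R) : 0 <= L ->
  measurable_fun SU2 f -> (forall x, `|f x| <= M) ->
  (forall g h, SU2 h -> `|lreg g f h - f h| <= L * su2_dist1 g) ->
  continuous_orbit f.
Proof.
move=> L0 mf fM fL.
have Lf : L2 f.
  apply: (L2_le mf (L2_cst haar M)) => x _ /=.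
  by rewrite -real_normK ?num_real// ler_pXn2r ?nnegrE// (le_trans _ (fM x)).
split=> // eta eta0.
near=> g.
(* Then the pointwise difference is at most the square root of [eta], and [mu] has total mass 1; L +
   1 is positive even for L = 0. *)
have gd : su2_dist1 g <= Num.sqrt eta / (L + 1).
  by near: g; apply: su2_dist1_small; rewrite divr_gt0 ?sqrtr_gt0// ltr_wpDl.
move=> gK; rewrite -(sqr_sqrtr (ltW eta0)) -(energy_cst haar).
apply: le_energy; [exact: (L2B (L2_lreg haar gK Lf) Lf).1|exact: L2_cst|].
move=> x xK; rewrite -real_normK ?num_real//.
rewrite ler_pXn2r ?nnegrE ?sqrtr_ge0//.
apply: le_trans (fL g x xK) _.
have := sqrtr_ge0 eta; have d0 : 0 <= su2_dist1 g by rewrite !addr_ge0.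
by move: gd; rewrite ler_pdivlMr ?ltr_wpDl//=; nra.
Unshelve. all: by end_near. Qed.

(** * From indicator functions to all of L2 *)

Lemma L2_indic (A : set (su2amb R)) : measurable A -> L2 \1_A.
Proof.
move=> mA; apply: (L2_le _ (L2_cst haar 1)) => [|x _].
  exact: measurable_funTS (measurable_indic mA).
by rewrite indicE; case: (_ \in _); rewrite /= ?expr0n ?expr1n.
Qed.

Lemma ramp_lipschitz (n c s t : R) : 0 <= n ->
  `|Num.min 1 (n * Num.max 0 (s - c)) - Num.min 1 (n * Num.max 0 (t - c))|
    <= n * `|s - t|.
Proof.
move=> n0.
wlog st : s t / t <= s.
  by move=> H; have [/H//|/ltW/H] := leP t s; rewrite distrC [`|s - t|]distrC.
rewrite [`|s - t|]ger0_norm ?subr_ge0//.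
have [m1 m2] : Num.max 0 (t - c) <= Num.max 0 (s - c) /\
    Num.max 0 (s - c) <= Num.max 0 (t - c) + (s - t).
  by rewrite !maxEle; do 2 case: ifPn; rewrite -?ltNge => *; lra.
move: (Num.max 0 (s - c)) (Num.max 0 (t - c)) m1 m2 => u v vu uv.
have nuv : n * v <= n * u by rewrite ler_wpM2l.
rewrite !minEle; do 2 case: ifPn; rewrite -?ltNge => *; rewrite ger0_norm; nra.
Qed.

(** The indicator of l > c is the pointwise limit from below of the Lipschitz ramps min(1, n max(0,
    l - c)). *)
Lemma continuous_orbit_halfspace (l : su2amb R -> R) (c : R) :
  measurable_fun setT l ->
  (forall g h, SU2 h -> `|lreg g l h - l h| <= su2_dist1 g) ->
  continuous_orbit \1_(l @^-1` `]c, +oo[%classic).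
Proof.
move=> ml ll.
have mA : measurable (l @^-1` `]c, +oo[%classic).
  by rewrite -[X in measurable X]setTI; apply: ml.
pose ramp n x := Num.min 1 (n%:R * Num.max 0 (l x - c)).
have mramp n : measurable_fun setT (ramp n).
  apply: measurable_minr; first exact: measurable_cst.
  apply: measurable_funM; first exact: measurable_cst.
  apply: measurable_maxr; first exact: measurable_cst.
  by apply: measurable_funB => //; exact: measurable_cst.
have r0 n x : 0 <= ramp n x <= 1.
  by rewrite /ramp ge_min lexx andbT le_min ler01 mulr_ge0// le_max lexx.
apply: (continuous_orbit_lim (s_ := ramp)).
- move=> n; apply: (continuous_orbit_lipschitz (L := n%:R) (M := 1)) => //.
  + exact: measurable_funTS (mramp n).
  + by move=> x; have /andP[h1 h2] := r0 n x; rewrite ger0_norm.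
  + move=> g h hK; apply: le_trans (ramp_lipschitz _ _ _ _) _ => //.
    by rewrite ler_wpM2l//; exact: ll.
- exact: L2_indic.
- move=> n x _; have /andP[-> /=] := r0 n x.
  rewrite indicE; have [|lc] := boolP (x \in _); first by [].
  rewrite /ramp; rewrite notin_setE /= in_itv/= andbT in lc.
  by rewrite max_l ?mulr0 ?ge_min ?lexx ?orbT//; move/negP: lc; rewrite -leNgt subr_le0.
- move=> x _; rewrite indicE; have [lc|lc] := boolP (x \in _).
    rewrite inE /= in_itv/= andbT in lc.
    apply: cvg_near_cst; exists (Num.truncn (l x - c)^-1).+1 => // n /= Nn.
    (* From n >= 1 / (l x - c) on, the ramp at x equals 1. *)
    have lc0 : 0 < l x - c by rewrite subr_gt0.
    rewrite /ramp max_r ?(ltW lc0)// min_l//.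
    rewrite -ler_pdivrMr// div1r ltW// (lt_le_trans (truncnS_gt _))//.
    by rewrite ler_nat.
  rewrite notin_setE /= in_itv/= andbT in lc.
  apply: cvg_near_cst; apply: nearW => n; rewrite /ramp max_l.
    by rewrite mulr0 min_r.
  by move/negP: lc; rewrite -leNgt subr_le0.
Qed.

(** Complements come from 1 - f, intersections from products, finite unions from De Morgan, and
    countable unions as limits from below of the finite ones. *)
Lemma continuous_orbit_sigma_algebra :
  sigma_algebra setT [set A | measurable A /\ continuous_orbit \1_A].
Proof.
have compl A : measurable A -> continuous_orbit \1_A -> continuous_orbit \1_(~` A).
  move=> mA cA; rewrite (_ : \1_(~` A) = fun x => cst 1 x + -1 * \1_A x).
    apply: continuous_orbitD (continuous_orbit_cst 1) _.
    exact: continuous_orbitZ.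
  by apply/funext => x; rewrite /= !indicE in_setC; case: (_ \in _) => /=; ring.
have inter A B : continuous_orbit \1_A -> continuous_orbit \1_B ->
    continuous_orbit \1_(A `&` B).
  move=> cA cB; rewrite (_ : \1_(A `&` B) = fun x => \1_A x * \1_B x).
    by apply: continuous_orbitM => // x; rewrite indicE;
      case: (_ \in _) => /=; apply/andP; split; lra.
  by apply/funext => x; rewrite !indicE in_setI; do 2 case: (_ \in _) => /=; ring.
have union A B : measurable A -> measurable B -> continuous_orbit \1_A ->
    continuous_orbit \1_B -> continuous_orbit \1_(A `|` B).
  move=> mA mB cA cB; rewrite -[A `|` B]setCK setCU; apply: (compl).
    by apply: measurableI; exact: measurableC.
  by apply: (inter); exact: compl.
split.
- split; first exact: measurable0.
  by rewrite indic0; exact: (continuous_orbit_cst 0).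
- move=> A [mA cA]; rewrite setTD; split; [exact: measurableC|exact: compl].
- move=> A hA; have mA n := (hA n).1; have cA n := (hA n).2.
  have mU : measurable (\bigcup_k A k) by exact: bigcupT_measurable.
  split=> //.
  pose F n := \big[setU/set0]_(k < n) A k.
  have mF n : measurable (F n) by apply: bigsetU_measurable.
  have cF n : continuous_orbit \1_(F n).
    elim: n => [|n ih].
      by rewrite /F big_ord0 indic0; exact: (continuous_orbit_cst 0).
    by rewrite /F big_ord_recr/=; apply: (union _ _ (mF n) (mA n) ih (cA n)).
  have FU n : F n `<=` \bigcup_k A k.
    by rewrite /F -bigcup_mkord => x [k _ ?]; exists k.
  apply: (continuous_orbit_lim (s_ := fun n => \1_(F n))) => //.
  + exact: L2_indic.
  + move=> n x _; rewrite !indicE ler0n/= ler_nat; case: (boolP (x \in F n)) => // xF.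
    by rewrite mem_set//; apply: (FU n); rewrite inE in xF.
  + move=> x _; rewrite indicE; have [xU|xU] := boolP (x \in _).
      move: xU; rewrite inE => -[k _ Akx].
      apply: cvg_near_cst; exists k.+1 => // n /= kn; rewrite indicE mem_set//.
      by rewrite /F -bigcup_mkord; exists k.
    apply: cvg_near_cst; apply: nearW => n; rewrite indicE memNset//.
    by move=> /FU; move: xU; rewrite notin_setE.
Qed.

Lemma continuous_orbit_indic (A : set (su2amb R)) :
  measurable A -> continuous_orbit \1_A.
Proof.
pose G := [set A | measurable A /\ continuous_orbit \1_A].
have sG := continuous_orbit_sigma_algebra.
(* With [G] as sigma-algebra on the source, measurability of the identity says that every Borel set
   lies in [G]. It is checked on each coordinate, where open half-lines generate. *)
move=> mA; suff : measurable_fun (setT : set (g_sigma_algebraType G))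
    (id : g_sigma_algebraType G -> su2amb R).
  move=> /(_ measurableT A mA); rewrite setTI preimage_id.
  by rewrite /measurable /= (sigma_algebra_id sG) => -[].
have coordM (l : su2amb R -> R) : measurable_fun setT l ->
    (forall g h, SU2 h -> `|lreg g l h - l h| <= su2_dist1 g) ->
    measurable_fun (setT : set (g_sigma_algebraType G))
      (l : g_sigma_algebraType G -> R).
  move=> ml ll; apply: (measurability _ (RGenOInfty.measurableE R)).
  move=> _ [_ [c ->] <-]; apply: sub_sigma_algebra; rewrite setTI; split.
    by rewrite -[X in measurable X]setTI; exact: ml.
  exact: continuous_orbit_halfspace.
have [m1 m2 m3 m4] := measurable_coord R.
rewrite (_ : id = fun x : su2amb R => ((x.1.1, x.1.2), (x.2.1, x.2.2))); last first.
  by apply/funext => -[[? ?] [? ?]].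
apply: measurable_fun_pair; apply: measurable_fun_pair; apply: (coordM) => // g h hK;
  by have [? ? ? ?] := coord_translate g hK.
Qed.

Lemma continuous_orbit_nnsfun (s : {nnsfun (su2amb R) >-> R}) : continuous_orbit s.
Proof.
rewrite (_ : (s : _ -> _) = fun x =>
  \sum_(y <- finmap.enum_fset (fset_set (range s))) y * \1_(s @^-1` [set y]) x); last first.
  by apply/funext => x; rewrite fimfunE fsbig_finite.
elim: (finmap.enum_fset _) => [|y r ih].
  under eq_fun do rewrite big_nil; exact: (continuous_orbit_cst 0).
under eq_fun do rewrite big_cons.
apply: continuous_orbitD ih; apply: continuous_orbitZ.
exact: continuous_orbit_indic.
Qed.

(** Nonnegative simple functions increase to f pointwise on SU(2). *)
Lemma continuous_orbit_ge0 f : L2 f -> (forall x, 0 <= f x) -> continuous_orbit f.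
Proof.
move=> Lf f0.
have mf : measurable_fun SU2 (EFin \o f) by apply/measurable_EFinP; exact: Lf.1.
have f0' x : SU2 x -> (0 <= (EFin \o f) x)%E by rewrite lee_fin.
pose s_ := nnsfun_approx (@measurable_SU2 R) mf.
have s_cvg x : SU2 x -> s_ ^~ x @ \oo --> f x.
  move=> xK; have := cvg_nnsfun_approx (@measurable_SU2 R) mf f0' xK.
  by move=> /fine_cvg.
apply: (continuous_orbit_lim (s_ := s_)) => //.
  by move=> n; exact: continuous_orbit_nnsfun.
move=> n x xK; apply/andP; split=> //.
have nd : nondecreasing_seq (s_ ^~ x).
  by move=> m k mk; exact/lefP/nd_nnsfun_approx.
rewrite -(cvg_lim (@Rhausdorff R) (s_cvg x xK)).
by apply: nondecreasing_cvgn_le => //; apply/cvg_ex; exists (f x); exact: s_cvg.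
Qed.

(** Strong continuity follows by splitting f into its positive and negative parts, both dominated by
    f in square. *)
Lemma L2_continuous_orbit f : L2 f -> continuous_orbit f.
Proof.
move=> Lf.
rewrite (_ : f = fun x => Num.max 0 (f x) + -1 * Num.max 0 (- f x)); last first.
  by apply/funext => x; rewrite !maxEle; do 2 case: ifPn; rewrite -?ltNge => *; lra.
have m0 (r : R) : 0 <= Num.max 0 r by rewrite le_max lexx.
have msq (r : R) : Num.max 0 r ^+ 2 <= r ^+ 2.
  by rewrite maxEle; case: ifPn => // _; rewrite expr0n sqr_ge0.
apply: continuous_orbitD; last apply: continuous_orbitZ;
  apply: continuous_orbit_ge0 => //; apply: (L2_le _ Lf).
- by apply: measurable_maxr; [exact: measurable_cst|exact: Lf.1].
- by move=> x _; exact: msq.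
- apply: measurable_maxr; first exact: measurable_cst.
  by apply: measurable_funN; exact: Lf.1.
- by move=> x _; rewrite -[leRHS]sqrrN; exact: msq.
Qed.

End StrongContinuity.

(** * Spectral gap *)

Section SpectralGap.
Variables (R : realType) (mu : probability (su2amb R) R).
Hypothesis haar : is_haar mu.
Local Notation SU2 := (@SU2 R).
Local Notation K := (set_type SU2).
Local Notation L2 := (L2 mu).
Local Notation energy := (energy mu).
Local Notation displacement := (displacement mu).
Implicit Types (u w : su2amb R -> R) (a b x y : K) (p : K * K).

Lemma L2normE u w : L2 u -> L2 w -> L2norm mu u w = Num.sqrt (energy u + energy w).
Proof.
move=> Lu Lw; rewrite /L2norm; congr Num.sqrt; apply: EFin_inj.
rewrite EFinD -!energyE// -ge0_integralD//; try by
  [exact: measurable_SU2|move=> *; exact: sqr_ge0_EFin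
  |exact: measurable_sqr Lu.1|exact: measurable_sqr Lw.1].
rewrite fineK//; apply: integrable_fin_num; first exact: measurable_SU2.
by have := integrableD (@measurable_SU2 R) Lu.2 Lw.2.
Qed.

(** Squared displacement of the complex function u + i w. *)
Definition disp2 u w a := displacement u (set_val a) + displacement w (set_val a).

Lemma disp2_ge0 u w a : 0 <= disp2 u w a.
Proof. by rewrite addr_ge0// energy_ge0. Qed.

(* Up to the value of the constant, the maximum of the two displacements may be
   replaced by their sum, and norms by their squares. *)
Definition gap_const (c : R) p := forall u w, inL2_0 mu u w ->
  c * (energy u + energy w) <= disp2 u w p.1 + disp2 u w p.2.

Lemma inL2_0_L2 u w : inL2_0 mu u w -> L2 u /\ L2 w.
Proof. by move=> [[]]. Qed.

Lemma L2norm_displacement u w a : L2 u -> L2 w ->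
  L2norm mu (fun h => lreg (set_val a) u h - u h)
    (fun h => lreg (set_val a) w h - w h) = Num.sqrt (disp2 u w a).
Proof.
have aK : SU2 (set_val a) := set_valP a.
by move=> Lu Lw; apply: L2normE; apply: L2B => //; exact: L2_lreg.
Qed.

Lemma SG2P p : SG2 mu p <-> exists2 c, 0 < c & gap_const c p.
Proof.
split=> [[e e0 he]|[c c0 hc]].
  exists (e ^+ 2) => [|u w v0]; first exact: exprn_gt0.
  have [Lu Lw] := inL2_0_L2 v0.
  have E0 : 0 <= energy u + energy w by rewrite addr_ge0// energy_ge0.
  have sq a : e * L2norm mu u w <= L2norm mu (fun h => lreg (set_val a) u h - u h)
      (fun h => lreg (set_val a) w h - w h) ->
      e ^+ 2 * (energy u + energy w) <= disp2 u w a.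
    rewrite L2norm_displacement// L2normE// => h.
    rewrite -[X in _ * X]sqr_sqrtr// -exprMn -[leRHS]sqr_sqrtr ?disp2_ge0//.
    by rewrite ler_pXn2r ?nnegrE ?mulr_ge0 ?sqrtr_ge0// ltW.
  have := disp2_ge0 u w p.1; have := disp2_ge0 u w p.2.
  have [g] := he u w v0; rewrite !inE => /orP[]/eqP-> /sq; lra.
(* One of the two displacements is at least half of their sum. *)
exists (Num.sqrt (c / 2)) => [|u w v0]; first by rewrite sqrtr_gt0 divr_gt0.
have [Lu Lw] := inL2_0_L2 v0.
have E0 : 0 <= energy u + energy w by rewrite addr_ge0// energy_ge0.
have sq a : c / 2 * (energy u + energy w) <= disp2 u w a ->
    Num.sqrt (c / 2) * L2norm mu u w <=
    L2norm mu (fun h => lreg (set_val a) u h - u h)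
      (fun h => lreg (set_val a) w h - w h).
  rewrite L2norm_displacement// L2normE// => h.
  have c20 : 0 <= c / 2 by rewrite divr_ge0// ltW.
  by rewrite -sqrtrM// ler_wsqrtr.
have h := hc u w v0.
have [h1|h1] := leP (c / 2 * (energy u + energy w)) (disp2 u w p.1).
  by exists (set_val p.1); [rewrite inE eqxx|exact: sq].
exists (set_val p.2); first by rewrite !inE eqxx orbT.
by apply: sq; lra.
Qed.

(** * Transfer of the gap along words and to limits *)

Lemma displacement_kmul x y (f : su2amb R -> R) : L2 f ->
  displacement f (set_val (kmul x y)) <=
  2 * (displacement f (set_val y) + displacement f (set_val x)).
Proof. exact: (displacement_mul haar (set_valP x) (set_valP y)). Qed.

(** Induction on the word; the point is that [C] does not depend on f. *)
Lemma displacement_word wd a b : exists2 C, 0 <= C & forall f : su2amb R -> R, L2 f ->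
  displacement f (set_val (weval wd a b)) <=
  C * (displacement f (set_val a) + displacement f (set_val b)).
Proof.
have d0 (f : su2amb R -> R) g : 0 <= displacement f g by exact: energy_ge0.
elim: wd => [||| s [C C0 hC] t [D D0 hD]] /=.
- exists 0 => // f Lf; rewrite mul0r /displacement.
  rewrite (eq_energy mu (f2 := cst 0)); first by rewrite energy_cst// expr0n.
  move=> x _; rewrite /lreg SU2_val_mk
    (_ : su2_inv (su2_one R) = su2_one R) ?su2_1mul ?subrr//.
  by rewrite /su2_inv/= oppr0.
- by exists 1 => // f _; rewrite mul1r lerDl.
- by exists 1 => // f _; rewrite mul1r lerDr.
- exists (2 * (C + D)); first by rewrite mulr_ge0// addr_ge0.
  move=> f Lf; apply: le_trans (displacement_kmul _ _ Lf) _.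
  by have := hC f Lf; have := hD f Lf; lra.
Qed.

Lemma gap_const_word s t c p : 0 < c ->
  gap_const c (weval s p.1 p.2, weval t p.1 p.2) ->
  exists2 c', 0 < c' & gap_const c' p.
Proof.
move=> c0 hc.
have [C C0 hC] := displacement_word s p.1 p.2.
have [D D0 hD] := displacement_word t p.1 p.2.
have CD0 : 0 < C + D + 1 by rewrite ltr_wpDl// addr_ge0.
(* The summand 1 keeps the denominator positive when C = D = 0. *)
exists (c / (C + D + 1)) => [|u w v0]; first by rewrite divr_gt0.
have [Lu Lw] := inL2_0_L2 v0.
have := hc u w v0; rewrite /disp2/= => h.
have := hC u Lu; have := hC w Lw; have := hD u Lu; have := hD w Lw.
have := disp2_ge0 u w p.1; have := disp2_ge0 u w p.2; rewrite /disp2.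
rewrite mulrAC ler_pdivrMr//; nra.
Qed.

(** For a fixed vector, strong continuity gives a nearby p' with constant c whose components move it
    almost as those of p do. The resulting constant does not depend on the vector. *)
Lemma gap_const_closure c p : 0 < c ->
  closure (gap_const c) p -> gap_const (c / 4) p.
Proof.
move=> c0 clp u w v0; have [Lu Lw] := inL2_0_L2 v0.
set E := energy u + energy w.
have [E0|E0] := leP E 0.
  apply: le_trans (_ : 0 <= _); last by rewrite addr_ge0// disp2_ge0.
  by rewrite pmulr_rle0// divr_gt0.
(* With S the sum of displacements at p, the estimates give c E <= 8 eta + 2 S; as 8 eta = c E / 2,
   S is at least c E / 4. *)
pose eta := c * E / 16; have eta0 : 0 < eta by rewrite divr_gt0// mulr_gt0.
have [_ cu] := L2_continuous_orbit haar Lu.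
have [_ cw] := L2_continuous_orbit haar Lw.
have nearK a (q : K * K -> K) : continuous q -> q p = a ->
    \forall p' \near p, disp2 u w (kmul (kinv a) (q p')) <= 2 * eta.
  move=> cq qp.
  have c1 : continuous (fun p' => set_val (kmul (kinv a) (q p'))).
    move=> p'.
    apply: (@continuous_comp _ _ _ (fun p' => kmul (kinv a) (q p')) set_val);
      last exact: kval_continuous.
    by apply: kmul_continuous => //; exact: cst_continuous.
  have /c1 : nbhs (set_val (kmul (kinv a) (q p)))
      [set g | SU2 g -> displacement u g <= eta /\ displacement w g <= eta].
    rewrite qp kVmul.
    apply: filterS2 (cu _ eta0) (cw _ eta0) => g h1 h2 gK.
    by split; [exact: h1|exact: h2].
  apply: (@filterS _ (nbhs p) _ _ _ _) => p' /(_ (set_valP (kmul (kinv a) (q p'))))[h1 h2].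
  by rewrite /disp2; lra.
have n1 : \forall p' \near p, disp2 u w (kmul (kinv p.1) p'.1) <= 2 * eta.
  by apply: (nearK p.1 fst) => // ?; exact: cvg_fst.
have n2 : \forall p' \near p, disp2 u w (kmul (kinv p.2) p'.2) <= 2 * eta.
  by apply: (nearK p.2 snd) => // ?; exact: cvg_snd.
have [p' [hp' [h1 h2]]] := clp _ (filterI n1 n2).
have tri a a' : disp2 u w a' <= 2 * (disp2 u w (kmul (kinv a) a') + disp2 u w a).
  rewrite {1}(_ : a' = kmul a (kmul (kinv a) a')); last first.
    by rewrite kmulA kmulV k1mul.
  have := displacement_kmul a (kmul (kinv a) a') Lu.
  have := displacement_kmul a (kmul (kinv a) a') Lw.
  by rewrite /disp2; lra.
have := hp' u w v0; have := tri p.1 p'.1; have := tri p.2 p'.2.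
rewrite -/E /=; rewrite /= in h1 h2; rewrite /eta in h1 h2; lra.
Qed.

Lemma meager_or_comeager_SG2 : meager (SG2 mu) \/ comeager (SG2 mu).
Proof.
pose F n : set (K * K) := gap_const n.+1%:R^-1.
have [nd|] := pselect (forall n, nowhere_dense (F n)).
  left; exists F; split=> // p /SG2P[c c0 hc].
  (* Here 1 / c < n + 1, so the constant c may be lowered to 1 / (n + 1). *)
  exists (Num.truncn c^-1) => // u w v0; apply: le_trans (hc u w v0).
  rewrite ler_wpM2r ?addr_ge0 ?energy_ge0//.
  by rewrite invf_ple ?posrE// ltW// truncnS_gt.
move=> /existsNP[n /eqP/set0P[q qU]]; right.
pose U := interior (closure (F n)).
have gapU p : U p -> exists2 c, 0 < c & gap_const c p.
  move=> /interior_subset /gap_const_closure h; exists (n.+1%:R^-1 / 4).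
    by rewrite divr_gt0.
  exact: h.
(* Pairs at which some two words land in [U]: an open set, contained in [SG2] by [gap_const_word].
   Its complement alone will cover the pairs without gap. *)
pose O := \bigcup_(s in setT) \bigcup_(t in setT)
  ((fun p : K * K => (weval s p.1 p.2, weval t p.1 p.2)) @^-1` U).
have oO : open O.
  apply: bigcup_open => s _; apply: bigcup_open => t _.
  apply: open_comp; last exact: open_interior.
  move=> p _; apply: (@cvg_pair _ _ _ _ (nbhs (weval s p.1 p.2)) (nbhs (weval t p.1 p.2)));
    exact: weval_continuous.
exists (fun=> ~` O); split=> [_|p nSG].
  rewrite /nowhere_dense -((closure_id (~` O)).1 (open_closedC oO)).
  apply/eqP; apply/negP => /negP/set0P[p pO].
  (* An interior point of the complement would yield, by density, a pair of [O] inside that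
     interior. *)
  have [p' + [s [t Up']]] := words_meet_open (open_interior _) (open_interior (~` O))
    (ex_intro _ q qU) (ex_intro _ p pO).
  by move=> /interior_subset; apply; exists s => //; exists t.
exists 0%N => //; apply: contra_not nSG => -[s _ [t _ /gapU[c c0 hc]]].
by apply/SG2P; exact: gap_const_word hc.
Qed.

End SpectralGap.

Theorem theorem1p2 (R : realType) (mu : probability (su2amb R) R) :
  is_haar mu -> meager (SG2 mu) \/ comeager (SG2 mu).
Proof. exact: meager_or_comeager_SG2. Qed.
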